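(* Let $(W,S)$ be a finite Coxeter group, $p$ a prime, and let $M^c(W)=(\beta_{JK})_{J,K\in E}$ be its parabolic table of marks. (1) The columns of $M^c(W)$ define the irreducible representations of $\Sigma_W$: for $K\in E$ the linear map $\lambda_K:\Sigma_W\to\mathbb{Q}$ given by $\lambda_K(x_J)=\beta_{JK}$ ($J\subseteq S$) is a one-dimensional representation, and the $\lambda_K$, $K\in E$, are exactly the irreducible representations of $\Sigma_W$ up to isomorphism. (2) The columns of $M^c(W)$ modulo $p$ define the irreducible representations of $\Sigma(W,p)$: the linear maps $\overline{\lambda}_K:\Sigma(W,p)\to\mathbb{F}_p$ given by $\overline{\lambda}_K(\overline{x}_J)=\beta_{JK}\bmod p$ ($J\subseteq S$), for $K\in E$, are exactly the irreducible representations of $\Sigma(W,p)$ up to isomorphism; and $M^c(W)$ modulo $p$ has precisely $s$ distinct columns, where $s$ is the number of $J\in E$ with $p\nmid[N_W(W_J):W_J]$.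
   Context: For $L\subseteq S$, $W_L=\langle L\rangle$, $X_L$ is the set of minimal length representatives of the left cosets $wW_L$ of $W_L$ in $W$, and $x_L=\sum_{w\in X_L}w\in\mathbb{Q}W$. By Solomon's theorem the $x_L$ ($L\subseteq S$) form a basis of a subalgebra $\Sigma_W$ of $\mathbb{Q}W$ (the descent algebra) with integer structure constants; $\mathcal{Z}_W$ is the $\mathbb{Z}$-span of the $x_L$, $\Sigma(W,p)=\mathcal{Z}_W/p\mathcal{Z}_W$ is the $p$-modular descent algebra over $\mathbb{F}_p$, and $\overline{x}_L$ is the image of $x_L$. $E$ is a set of representatives of the $W$-conjugacy classes of subsets of $S$. For $J,K\subseteq S$, $\beta_{JK}$ is the number of fixed points of $W_K$ on $W/W_J$ (it depends only on the conjugacy classes of $J$ and $K$); it equals $\chi_J(c_K)$, where $\chi_J$ is the permutation character of $W$ on the cosets of $W_J$ and $c_K$ is a Coxeter element of $W_K$. *)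

(* Defs.v *)
From HB Require Import structures.
From mathcomp Require Import all_boot all_order all_algebra all_fingroup.
From mathcomp Require Import mxrepresentation boolp.

Set Implicit Arguments.
Unset Strict Implicit.
Unset Printing Implicit Defensive.

Import GRing.Theory.

Section CoxeterGroups.

Local Open Scope group_scope.

Variables (gT : finGroupType) (W : {group gT}) (S : {set gT}).

(* The last clause is the universal property of the presentation with          *)
(* generators S and relations (s t)^m(s,t) = 1, where m(s,t) is the order of   *)
(* s t in W. The relations s^2 = 1 are the case s = t. The target group H is   *)
(* not required to be finite.                                                  *)
Definition coxeter_system : Prop :=
  [/\ <<S>> = W,
      {in S, forall s, #[s] = 2%N} &
      forall (H : groupType) (f : gT -> H),
        {in S &, forall s t, (f s * f t) ^+ #[s * t] = 1} ->
        exists2 phi : gT -> H,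
          {in W &, {morph phi : x y / x * y}} & {in S, phi =1 f}].

(* S ^+ k is the set of products of k elements of S; an element of <<S>> has   *)
(* length less than #|gT|, and elements outside <<S>> get the value #|gT|.+1.  *)
Definition cox_length (w : gT) : nat :=
  find (fun k => w \in S ^+ k) (iota 0 #|gT|.+1).

Definition min_lcoset_reps (L : {set gT}) : {set gT} :=
  [set w in W | [forall u in <<L>>, cox_length w <= cox_length (w * u)]].

(* The fixed points are counted on the left cosets w <<J>>, with <<K>> acting  *)
(* by left multiplication.                                                     *)
Definition mark (J K : {set gT}) : nat :=
  #|[set C in lcosets <<J>> W | [forall u in <<K>>, u *: C == C]]|.

Definition subset_class_reps (E : {set {set gT}}) : bool :=
  is_transversal E
    (equivalence_partition
       (fun J K : {set gT} => [exists w in W, K == J :^ w]) (powerset S))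
    (powerset S).

Definition parabolic_table_of_marks (E : {set {set gT}}) : 'M[nat]_#|E| :=
  \matrix_(i, j) mark (enum_val i) (enum_val j).

End CoxeterGroups.

Local Open Scope ring_scope.

(* The product of A is given by its graph, mul a b c meaning a b = c, and its  *)
(* unit by the predicate one.                                                  *)
Section Representations.

Variables (F : fieldType) (A : lmodType F).
Variables (mul : A -> A -> A -> Prop) (one : A -> Prop).

Definition is_representation n (rho : A -> 'M[F]_n) : Prop :=
  [/\ linear rho,
      forall a b c, mul a b c -> rho c = rho a *m rho b &
      forall e, one e -> rho e = 1%:M].

(* F^n is the left A-module of column vectors. *)
Definition is_irreducible n (rho : A -> 'M[F]_n) : Prop :=
  (0 < n)%N /\
  forall U : {vspace 'cV[F]_n},
    (forall a v, v \in U -> rho a *m v \in U) -> U = 0%VS \/ U = fullv.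

Definition is_irrep n (rho : A -> 'M[F]_n) : Prop :=
  is_representation rho /\ is_irreducible rho.

Definition isomorphic_repr m n (rho : A -> 'M[F]_m) (tau : A -> 'M[F]_n) :=
  exists2 P : 'M[F]_(n, m),
    row_free P && row_full P & forall a, P *m rho a = tau a *m P.

Definition repr1 (lam : A -> F) (a : A) : 'M[F]_1 := (lam a)%:M.

(* The lam i for i in E are irreducible representations and every irreducible  *)
(* representation is isomorphic to one of them; repetitions are allowed.       *)
Definition irreps_are (I : finType) (E : {set I}) (lam : I -> A -> F) : Prop :=
  (forall i, i \in E -> is_irrep (repr1 (lam i))) /\
  (forall n (rho : A -> 'M[F]_n), is_irrep rho ->
     exists2 i, i \in E & isomorphic_repr rho (repr1 (lam i))).

End Representations.

(* The group algebra QW is realised inside 'M[rat]_#|W| by the regular         *)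
(* representation of W, so that its product is *m and its unit 1%:M.           *)
Section DescentAlgebras.

Variables (gT : finGroupType) (W : {group gT}) (S : {set gT}).

Definition x_elt (L : {set gT}) : 'M[rat]_#|W| :=
  gset_mx rat W (min_lcoset_reps W S L).

Definition descent_space : {vspace 'M[rat]_#|W|} :=
  <<[seq x_elt L | L in powerset S]>>%VS.

Definition descent_algebra : vectType rat := subvs_of descent_space.

(* By Solomon's theorem every pair a, b has a product. *)
Definition descent_mul (a b c : descent_algebra) : Prop :=
  vsval c = vsval a *m vsval b.

Definition descent_one (e : descent_algebra) : Prop := vsval e = 1%:M.

Definition descent_lattice : {pred 'M[rat]_#|W|} :=
  fun v => `[< exists a : {set gT} -> int,
                 v = \sum_(L : {set gT} | L \subset S) x_elt L *~ a L >].

Fact descent_lattice_zmod_closed : zmod_closed descent_lattice.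
Proof.
split=> [|u v /asboolP[a ->] /asboolP[b ->]]; apply/asboolP.
  by exists (fun=> 0); rewrite big1 // => L _; rewrite mulr0z.
exists (fun L => a L - b L); rewrite -sumrB; apply: eq_bigr => L _.
by rewrite mulrzBr.
Qed.
HB.instance Definition _ :=
  GRing.isZmodClosed.Build _ descent_lattice descent_lattice_zmod_closed.

Definition int_descent := {v | v \in descent_lattice}.
HB.instance Definition _ := SubChoice.on int_descent.
HB.instance Definition _ := [SubChoice_isSubZmodule of int_descent by <:].

Variable p : nat.

Definition int_descent_mulp : {pred int_descent} :=
  fun z => `[< exists y : int_descent, z = y *+ p >].

Fact int_descent_mulp_zmod_closed : zmod_closed int_descent_mulp.
Proof.
split=> [|_ _ /asboolP[y ->] /asboolP[z ->]]; apply/asboolP.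
  by exists 0; rewrite mul0rn.
by exists (y - z); rewrite mulrnBl.
Qed.
HB.instance Definition _ :=
  GRing.isZmodClosed.Build _ int_descent_mulp int_descent_mulp_zmod_closed.

(* The proof argument provides the structure of vector space over 'F_p, whose  *)
(* definition is only meaningful for p prime.                                  *)
Definition mod_descent (p_pr : prime p) : Type := Quotient.quot int_descent_mulp.

Section ModDescent.

Hypothesis p_pr : prime p.

HB.instance Definition _ := GRing.Zmodule.on (mod_descent p_pr).

Definition mod_pi (z : int_descent) : mod_descent p_pr :=
  (\pi_(Quotient.quot int_descent_mulp) z)%qT.

Definition mod_scale (a : 'F_p) (x : mod_descent p_pr) : mod_descent p_pr :=
  x *+ (a : nat).

Fact mod_descent_mulrp (x : mod_descent p_pr) : x *+ p = 0.
Proof.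
rewrite -[x](@reprK _ (Quotient.quot int_descent_mulp)) -raddfMn.
apply/eqP; rewrite -(raddf0 (\pi_(Quotient.quot int_descent_mulp))%qT).
rewrite -Quotient.idealrBE subr0; apply/asboolP.
by eexists.
Qed.

Fact mod_descent_modn (x : mod_descent p_pr) m :
  x *+ (m %% (Zp_trunc (pdiv p)).+2) = x *+ m.
Proof.
rewrite Fp_cast // {2}(divn_eq m p) mulrnDr mulnC mulrnA.
by rewrite mod_descent_mulrp mul0rn add0r.
Qed.

Fact mod_scaleA a b x : mod_scale a (mod_scale b x) = mod_scale (a * b) x.
Proof. by rewrite /mod_scale /= mod_descent_modn mulnC mulrnA. Qed.

Fact mod_scale1 : left_id 1 mod_scale.
Proof. by move=> x; rewrite /mod_scale /= mod_descent_modn. Qed.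

Fact mod_scaleDr : right_distributive mod_scale +%R.
Proof. by move=> a x y; rewrite /mod_scale mulrnDl. Qed.

Fact mod_scaleDl x : {morph mod_scale^~ x : a b / a + b}.
Proof. by move=> a b; rewrite /mod_scale /= mod_descent_modn mulrnDr. Qed.

HB.instance Definition _ :=
  GRing.Zmodule_isLmodule.Build 'F_p (mod_descent p_pr)
    mod_scaleA mod_scale1 mod_scaleDr mod_scaleDl.

(* Products in the quotient are computed on representatives. *)
Definition mod_mul (a b c : mod_descent p_pr) : Prop :=
  exists x y z : int_descent,
    [/\ mod_pi x = a, mod_pi y = b, mod_pi z = c & val z = val x *m val y].

Definition mod_one (e : mod_descent p_pr) : Prop :=
  exists2 z : int_descent, mod_pi z = e & val z = 1%:M.

End ModDescent.
End DescentAlgebras.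

Arguments descent_mul {gT} W S a b c.
Arguments descent_one {gT} W S e.
Arguments mod_mul {gT} W S {p} p_pr a b c.
Arguments mod_one {gT} W S {p} p_pr e.

(* Main.v *)
(* By the exchange property, the inversion sets of the elements of W satisfy  *)
(* the cocycle rule N(w w') = N(w') + w'^-1 N(w) w' (symmetric difference),   *)
(* and X_L is the set of w with no inversion in L. Splitting b in X_K as      *)
(* b = u d with u in W_J and d minimal in its double coset turns products     *)
(* a b with a in X_J into Solomon's formula                                   *)
(*   x_J x_K = \sum_d x_(J^d :&: K).                                          *)
(* Hence left multiplication is triangular on the basis of the x_K ordered by *)
(* inclusion, with beta_JK as the coefficient of x_K in x_J x_K. So the       *)
(* diagonal coefficients are characters, over Q and modulo p alike. If v is a *)
(* nonzero vector of an irreducible representation and K has minimal size with *)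
(* x_K v <> 0, then x_K v spans an invariant line on which x_J acts by        *)
(* beta_JK, which gives all irreducible representations at once.              *)
(* Equality of the columns K and L makes beta_KL and beta_LK nonzero as soon  *)
(* as beta_KK = [N(W_K) : W_K] and beta_LL are, and then K and L are          *)
(* conjugate. If p divides [N(W_K) : W_K], a p-subgroup P of N(W_K) not       *)
(* contained in W_K acts on the fixed points of W_K, so modulo p the column of *)
(* K is that of the parabolic closure of W_K P, which is larger than W_K.     *)
Require Import Defs.
From HB Require Import structures.
From mathcomp Require Import all_boot all_order all_algebra all_fingroup.
From mathcomp Require Import mxrepresentation boolp.
From mathcomp Require Import pgroup sylow.

Set Implicit Arguments.
Unset Strict Implicit.
Unset Printing Implicit Defensive.

Import GRing.Theory.

(** * The inversion cocycle *)

Section InversionCocycle.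

Local Open Scope group_scope.

(** The universal property of the presentation enters once, in [inversion_cocycle_exists]. From the
    cocycle rule come the length as the number of inversions ([cox_lengthE]), minimal coset
    representatives as the elements without inversions in L ([mem_X]), and the intersections of
    parabolic subgroups ([dcoset_inter], [parabolic_inter]). Solomon's formula [solomon_sum] then
    yields the structure constants [x_mul], and [mark_Solomon] identifies the diagonal ones with the
    marks. The diagonal coefficients are characters over Q ([x_charM]) with integral values on the
    lattice, so they reduce modulo p ([mod_char_exists]); [triangular_irrep] shows over either field
    that there are no other irreducible representations. Two marks in opposite positions are both
    nonzero only for equal representatives ([mark_sep]), which separates columns. Modulo p,
    [mark_mod_rep] replaces any column by one whose diagonal entry is prime to p, which gives the
    count. *)

Definition sign_fun (gT : finGroupType) (s : gT) (x : gT * bool) : gT * bool :=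
  (x.1 ^ s, x.2 (+) (x.1 == s)).

Lemma sign_fun_inj (gT : finGroupType) (s : gT) : injective (sign_fun s).
Proof. by move=> [t a] [t' a'] [/conjg_inj <-] /addIb <-. Qed.

(** The classical action of a generator on signed reflections, extended to all of [gT * bool] so
    that no set of reflections has to be singled out. *)
Definition sign_perm (gT : finGroupType) (s : gT) : {perm gT * bool} :=
  perm (@sign_fun_inj gT s).

(* With r = s s', the sign picked up by t along (s s')^m counts the j < 2m    *)
(* such that t = r^j s, which is even since r has order m.                    *)
Lemma sign_perm_rel (gT : finGroupType) (s s' : gT) :
  #[s] = 2%N -> #[s'] = 2%N ->
  (sign_perm s * sign_perm s') ^+ #[s * s'] = 1.
Proof.
move=> os os'.
have sV : s^-1 = s by rewrite invg_expg os.
have s'V : s'^-1 = s' by rewrite invg_expg os'.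
set r := s * s'; set m := #[r].
have rJ1 : s * r^-1 = r * s by rewrite /r invMg sV s'V mulgA.
have rJ i : s * r ^- i = r ^+ i * s.
  elim: i => [|i IHi]; first by rewrite expg0 invg1 mulg1 mul1g.
  by rewrite [in LHS]expgS invMg mulgA IHi -mulgA rJ1 mulgA -expgSr.
have step n t a : ((sign_perm s * sign_perm s') ^+ n) (t, a) =
    (t ^ (r ^+ n), a (+) \big[addb/false]_(0 <= j < n.*2) (t == r ^+ j * s)).
  elim: n => [|n IHn] in t a *.
    by rewrite !expg0 perm1 big_geq // conjg1 addbF.
  rewrite expgSr permM IHn permM !permE /sign_fun /= -!conjgM -/r -expgSr.
  rewrite doubleS !big_nat_recr //= !addbA.
  congr (_, _ (+) _ (+) _).
    rewrite -(inj_eq (conjg_inj (r ^- n))) conjgK conjgE invgK rJ mulgA.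
    by rewrite -expgD addnn.
  rewrite -(inj_eq (conjg_inj (r ^+ n * s)^-1)) conjgK conjgE invgK.
  have -> : r ^+ n * s * (s' * (r ^+ n * s)^-1) = r ^+ n * r * (s * r ^- n).
    by rewrite invMg sV !mulgA -(mulgA _ s s') -/r.
  by rewrite rJ mulgA -expgSr -expgD addSn addnn.
apply/permP=> [[t a]]; rewrite step perm1 expg_order conjg1; congr pair.
rewrite -addnn (@big_cat_nat _ _ _ m) //= ?leq_addr //.
rewrite -[X in \big[_/_]_(X <= _ < m + m) _]add0n big_addn addnK.
under [X in _ (+) (_ (+) X)]eq_bigr do rewrite expgD expg_order mulg1.
by rewrite addbb addbF.
Qed.

(* For w in W these properties determine inv w, as the set of reflections t    *)
(* such that w t is shorter than w.                                            *)
Definition inversion_cocycle (gT : finGroupType) (W : {group gT})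
    (S : {set gT}) (inv : gT -> {set gT}) :=
  {in W &, forall w w' t,
     (t \in inv (w * w')) = (t \in inv w') (+) (t ^ w'^-1 \in inv w)} /\
  {in S, forall s, inv s = [set s]}.

Lemma inversion_cocycle_exists (gT : finGroupType) (W : {group gT})
    (S : {set gT}) :
  coxeter_system W S -> exists inv, inversion_cocycle W S inv.
Proof.
case=> defW oS /(_ _ (@sign_perm gT)) [|phi phiM phiS].
  by move=> s s' Ss Ss'; apply: sign_perm_rel; apply: oS.
have phi1 : phi 1 = 1.
  by apply: (mulgI (phi 1)); rewrite -phiM ?mulg1.
have phiE w t a : w \in W ->
    phi w (t, a) = (t ^ w, a (+) (phi w (t, false)).2).
  rewrite -{1}defW => /gen_prodgP[n [c Sc ->]] {w}.
  have Wc i : c i \in W by rewrite -defW mem_gen.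
  elim: n => [|n IHn] in c Sc Wc t a *.
    by rewrite big_ord0 phi1 !perm1 conjg1 addbF.
  rewrite big_ord_recr /= phiM ?group_prod // !permM.
  rewrite IHn // [in RHS]IHn // phiS ?Sc //.
  by rewrite !permE /sign_fun /= conjgM addbA.
(* Permutations compose from left to right, so the sign of w itself detects the t with t w shorter;
   passing to the inverse puts t on the right. *)
exists (fun w => [set t | (phi w^-1 (t, false)).2]).
split=> [w w' Ww Ww' t|s Ss].
  rewrite !inE invMg phiM ?groupV // permM [in LHS]phiE ?groupV //=.
  by rewrite [in LHS]phiE ?groupV.
apply/setP=> t; rewrite !inE.
have -> : s^-1 = s by rewrite invg_expg oS.
by rewrite phiS // permE.
Qed.

End InversionCocycle.

(** * One-dimensional representations *)

Section OneDimensionalRepresentations.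

Local Open Scope ring_scope.

Variables (F : fieldType) (A : lmodType F).
Variables (mul : A -> A -> A -> Prop) (one : A -> Prop).

Lemma repr1_irreducible (lam : A -> F) : is_irreducible (repr1 lam).
Proof.
split=> // U _; have := dimvS (subvf U); rewrite dimvf /dim /= muln1.
case dimU: (\dim U) => [|[|//]] _.
  by left; apply/eqP; rewrite -dimv_eq0 dimU.
by right; apply/eqP; rewrite eqEdim subvf dimU dimvf /dim /=.
Qed.

Lemma repr1_irrep (lam : {linear A -> F^o}) :
  (forall a b c, mul a b c -> lam c = lam a * lam b) ->
  (forall e, one e -> lam e = 1) -> is_irrep mul one (repr1 lam).
Proof.
move=> lamM lam1; split; last exact: repr1_irreducible.
split=> [k u v|a b c /lamM|e /lam1]; rewrite /repr1.
- by rewrite linearP raddfD /= scale_scalar_mx.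
- by move=> ->; rewrite scalar_mxM.
- by move=> ->.
Qed.

Lemma isomorphic_repr1 (lam mu : A -> F) :
  isomorphic_repr (repr1 lam) (repr1 mu) -> lam =1 mu.
Proof.
case=> P /andP[freeP _] eqP a; move/(congr1 (fun M : 'M_1 => M 0 0)): (eqP a).
rewrite /repr1 mul_mx_scalar mul_scalar_mx !mxE => /mulIf; apply.
apply: contraTneq freeP => P0; rewrite row_free_unit.
by rewrite unitmxE det_mx11 P0 unitr0.
Qed.

(** Take K of minimal rank with [e K] not killing a nonzero vector v; [top] provides a candidate
    since it acts as 1. In [e J] times [e K] the terms of lower rank kill v, so the image of v under
    [e K] is a common eigenvector and spans the whole module. *)
Lemma triangular_irrep (I : finType) (D : {set I}) (e : I -> A)
    (rk : I -> nat) (lam : I -> {linear A -> F^o}) (top : I) :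
  top \in D -> one (e top) ->
  (forall a, exists c : I -> F, a = \sum_(L in D) c L *: e L) ->
  (forall J K, J \in D -> K \in D -> exists c : I -> F,
     mul (e J) (e K) (lam K (e J) *: e K +
                      \sum_(L in D | (rk L < rk K)%N) c L *: e L)) ->
  forall n (rho : A -> 'M[F]_n), is_irrep mul one rho ->
  exists2 K, K \in D & isomorphic_repr rho (repr1 (lam K)).
Proof.
move=> Dtop onetop spanD mulD n rho0 [[lin_rho rhoM rho1] [n_gt0 irr]].
pose rho : {linear A -> 'M[F]_n} := HB.pack_for {linear A -> 'M[F]_n} rho0
  (GRing.isLinear.Build F A 'M[F]_n _ rho0 lin_rho).
pose v : 'cV[F]_n := delta_mx (Ordinal n_gt0) 0.
have v_neq0 : v != 0.
  apply/eqP => /matrixP/(_ (Ordinal n_gt0) 0)/eqP.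
  by rewrite !mxE !eqxx oner_eq0.
pose P K := (K \in D) && (rho (e K) *m v != 0).
have Ptop : P top by rewrite /P Dtop [rho _]rho1 // mul1mx.
case: (arg_minnP rk Ptop) => K /andP[DK u_neq0] minK.
exists K => //; set u := rho (e K) *m v in u_neq0.
have rho_u a : rho a *m u = lam K a *: u.
  have rho_e J : J \in D -> rho (e J) *m u = lam K (e J) *: u.
    move=> DJ; have [c /rhoM mulJK] := mulD J K DJ DK.
    rewrite /u mulmxA -[_ *m rho (e K)]mulJK [rho0 _](linearD rho) mulmxDl.
    rewrite linearZ -scalemxAl linear_sum mulmx_suml big1 ?addr0 // => L.
    case/andP=> DL ltLK; rewrite linearZ -scalemxAl.
    suffices /eqP-> : rho (e L) *m v == 0 by rewrite scaler0.
    by apply: contraLR ltLK => nzL; rewrite -leqNgt minK // /P DL.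
  have [c ->] := spanD a.
  rewrite [rho _]linear_sum mulmx_suml [lam K _]linear_sum scaler_suml.
  apply: eq_bigr => L DL; rewrite [rho _]linearZ [lam K _]linearZ.
  by rewrite -scalemxAl rho_e // scalerA.
have [|U0|Ufull] := irr <[u]>%VS.
- move=> a _ /vlineP[k ->]; rewrite -[rho0]/(rho : A -> _) -scalemxAr rho_u.
  by rewrite !memvZ ?memv_line.
- by case/eqP: u_neq0; apply/eqP; rewrite -memv0 -U0 memv_line.
have n1 : n = 1%N.
  by have := dim_vline u; rewrite Ufull dimvf /dim /= muln1 u_neq0.
subst n; exists 1%:M => [|a].
  by rewrite row_free_unit row_full_unit unitmx1.
rewrite mul1mx mulmx1 /repr1 [LHS]mx11_scalar; congr _%:M.
have u0_neq0 : u 0 0 != 0.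
  by apply: contraNneq u_neq0 => u0; rewrite [u]mx11_scalar u0 raddf0.
apply: (mulIf u0_neq0); have /matrixP/(_ 0 0) := rho_u a.
by rewrite [RHS]mxE mxE big_ord1.
Qed.

End OneDimensionalRepresentations.

(** * Lengths, cosets and double cosets *)

Section Inversions.

Local Open Scope group_scope.

Variables (gT : finGroupType) (W : {group gT}) (S : {set gT}).
Variable inv : gT -> {set gT}.
Hypotheses (coxWS : coxeter_system W S) (invP : inversion_cocycle W S inv).

Local Notation X := (min_lcoset_reps W S).

Implicit Types (J K L : {set gT}) (s t u v w a d : gT).

Lemma cox_gen : <<S>> = W. Proof. by case: coxWS. Qed.

Lemma cox_sub L : L \subset S -> <<L>> \subset W.
Proof. by rewrite -cox_gen; apply: genS. Qed.

Lemma cox_mem s : s \in S -> s \in W.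
Proof. by rewrite -cox_gen; apply: mem_gen. Qed.

Lemma cox_genW L u : L \subset S -> u \in <<L>> -> u \in W.
Proof. by move/cox_sub/subsetP; apply. Qed.

Lemma cox_inv s : s \in S -> s^-1 = s.
Proof. by case: coxWS => _ oS _ /oS os; rewrite invg_expg os. Qed.

Lemma cox_mulKs w s : s \in S -> w * s * s = w.
Proof. by move=> Ss; rewrite -{2}(cox_inv Ss) mulgK. Qed.

Lemma inv_mul w w' t : w \in W -> w' \in W ->
  (t \in inv (w * w')) = (t \in inv w') (+) (t ^ w'^-1 \in inv w).
Proof. by case: invP => invM _ Ww Ww'; apply: invM. Qed.

Lemma inv1 : inv 1 = set0.
Proof.
apply/setP=> t; rewrite inE -[1]mulg1 inv_mul // invg1 conjg1.
by case: (t \in _).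
Qed.

Lemma inv_s s : s \in S -> inv s = [set s].
Proof. by case: invP => _; apply. Qed.

Lemma inv_V w t : w \in W -> (t \in inv w^-1) = (t ^ w \in inv w).
Proof.
move=> Ww; have := inv_mul (t ^ w) (groupVr Ww) Ww.
rewrite mulVg inv1 inE conjgK.
by case: (_ \in _) (_ \in _) => [] [].
Qed.

Lemma card_inv_V w : w \in W -> #|inv w^-1| = #|inv w|.
Proof.
move=> Ww; have -> : inv w^-1 = inv w :^ w^-1.
  by apply/setP=> t; rewrite inv_V // mem_conjg invgK.
exact: cardJg.
Qed.

Lemma card_inv_up w s : w \in W -> s \in S -> s \notin inv w ->
  #|inv (w * s)| = #|inv w|.+1.
Proof.
move=> Ww Ss nws; have sV := cox_inv Ss.
have -> : inv (w * s) = s |: inv w :^ s.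
  apply/setP=> t; rewrite inv_mul // ?cox_mem // inv_s // !inE mem_conjg sV.
  by case: eqP => [->|//] /=; rewrite conjgE mulKg (negPf nws).
by rewrite cardsU1 mem_conjg sV conjgE mulKg nws cardJg.
Qed.

Lemma card_inv_down w s : w \in W -> s \in S -> s \in inv w ->
  #|inv w| = #|inv (w * s)|.+1.
Proof.
move=> Ww Ss ws; have Ws := cox_mem Ss.
rewrite -(@card_inv_up _ s) ?groupM ?cox_mulKs //.
by rewrite inv_mul // inv_s // inE eqxx cox_inv // conjgE mulKg ws.
Qed.

Lemma gen_ind_r (L : {set gT}) (P : gT -> Prop) :
  L \subset S -> P 1 ->
  (forall u s, u \in <<L>> -> s \in L -> P u -> P (u * s)) ->
  forall u, u \in <<L>> -> P u.
Proof.
move=> sLS P1 PS u /gen_prodgP[n [c Lc ->]] {u}.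
elim: n => [|n IHn] in c Lc *; first by rewrite big_ord0.
rewrite big_ord_recr /=; apply: PS => //; last exact: IHn.
by apply: group_prod => i _; apply: mem_gen.
Qed.

Lemma inv_gen L u : L \subset S -> u \in <<L>> -> inv u \subset <<L>>.
Proof.
move=> sLS; move: u; apply: gen_ind_r => // [|u s Lu Ls sIL].
  by rewrite inv1 sub0set.
have [Ss Wu] := (subsetP sLS s Ls, cox_genW sLS Lu).
apply/subsetP=> t; rewrite inv_mul // ?cox_mem // inv_s // inE.
have [->|_] /= := eqVneq t s; first by rewrite mem_gen.
by move/(subsetP sIL); rewrite groupJr // groupV mem_gen.
Qed.

Lemma prod_setP L k w :
  reflect (exists2 w', w' \in L ^+ k & exists2 s, s \in L & w = w' * s)
          (w \in L ^+ k.+1).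
Proof.
rewrite expgSr; apply: (iffP mulsgP) => [[w' s Lw' Ls ->]|[w' Lw' [s Ls ->]]].
  by exists w' => //; exists s.
by exists w' s.
Qed.

Lemma prod_set_gen L k w : w \in L ^+ k -> w \in <<L>>.
Proof.
elim: k w => [|k IHk] w; first by rewrite expg0 => /set1gP->.
by case/prod_setP=> w' /IHk Lw' [s Ls ->]; rewrite groupM // mem_gen.
Qed.

(** Strong exchange: an inversion of w' s is either s, and the last letter is dropped, or it comes
    from an inversion of w', and an earlier letter is dropped. For k = 0 there are no inversions. *)
Lemma exchange L k w t : L \subset S -> w \in L ^+ k -> t \in inv w ->
  w * t \in L ^+ k.-1.
Proof.
move=> sLS; elim: k w t => [|k IHk] w t.
  by rewrite expg0 => /set1gP->; rewrite inv1 inE.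
case/prod_setP=> w' Lw' [s Ls ->] /=; have Ss := subsetP sLS s Ls.
have Ww' := cox_genW sLS (prod_set_gen Lw').
rewrite inv_mul // ?cox_mem // inv_s // inE.
have [->|_] /= := eqVneq t s; first by rewrite cox_mulKs.
case: k => [|k] in IHk Lw' *.
  by move: Lw'; rewrite expg0 => /set1gP->; rewrite inv1 inE.
move/(IHk _ _ Lw') => /= Lw't; apply/prod_setP.
exists (w' * t ^ s^-1) => //; exists s => //.
by rewrite conjgE invgK !mulgA mulgKV.
Qed.

Lemma card_inv_leq L k w : L \subset S -> w \in L ^+ k -> #|inv w| <= k.
Proof.
move=> sLS; elim: k w => [|k IHk] w.
  by rewrite expg0 => /set1gP->; rewrite inv1 cards0.
case/prod_setP=> w' Lw' [s Ls ->]; have Ss := subsetP sLS s Ls.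
have Ww' := cox_genW sLS (prod_set_gen Lw').
have [w's|nw's] := boolP (s \in inv w'); last by rewrite card_inv_up ?ltnS ?IHk.
by rewrite -ltnS -card_inv_down // !leqW // IHk.
Qed.

(** With [card_inv_leq] this makes the number of inversions the length, and the same length in
    [<<L>>] as in W, since all letters are taken from L. *)
Lemma reduced_word L w : L \subset S -> w \in <<L>> -> w \in L ^+ #|inv w|.
Proof.
move=> sLS; move: w; apply: gen_ind_r => // [|w s Lw Ls IHw].
  by rewrite inv1 cards0 expg0 set11.
have [Ss Ww] := (subsetP sLS s Ls, cox_genW sLS Lw).
have [ws|nws] := boolP (s \in inv w).
  by have:= exchange sLS IHw ws; rewrite (card_inv_down Ww Ss ws).
by rewrite card_inv_up // ; apply/prod_setP; exists w => //; exists s.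
Qed.

Lemma cox_lengthE w : w \in W -> cox_length S w = #|inv w|.
Proof.
move=> Ww; rewrite /cox_length; set P := (fun _ => _); set s := iota _ _.
have szs : size s = #|gT|.+1 by rewrite size_iota.
have lt_inv : #|inv w| < #|gT|.+1 by rewrite ltnS max_card.
have Pinv : P #|inv w| by rewrite /P reduced_word // cox_gen.
have Ps : has P s by apply/hasP; exists #|inv w|; rewrite // mem_iota.
apply/eqP; rewrite eqn_leq; apply/andP; split.
  rewrite leqNgt; apply/negP => /(before_find 0).
  by rewrite nth_iota // add0n Pinv.
have := nth_find 0 Ps; rewrite nth_iota; last by rewrite -szs -has_find.
by rewrite add0n; apply: card_inv_leq.
Qed.

Lemma card_inv_mul L a u : L \subset S -> a \in W -> u \in <<L>> ->
  [disjoint inv a & <<L>>] -> #|inv (a * u)| = (#|inv a| + #|inv u|)%N.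
Proof.
move=> sLS Wa Lu dis; have Wu := cox_genW sLS Lu.
have disu t : t \in inv u -> t \notin inv a :^ u.
  move/(subsetP (inv_gen sLS Lu)) => Lt.
  rewrite mem_conjg; apply/negP => /(disjointFr dis).
  by rewrite groupJr ?groupV // Lt.
have -> : inv (a * u) = inv a :^ u :|: inv u.
  apply/setP=> t; rewrite inv_mul // inE mem_conjg; have := disu t.
  by rewrite mem_conjg; case: (t \in _) => [/(_ isT)/negPf->|_]; rewrite ?orbF.
rewrite cardsU cardJg [_ :&: _](_ : _ = set0) ?cards0 ?subn0 //.
apply/eqP/set0Pn=> -[t /setIP[at_ /disu]]; by rewrite at_.
Qed.

Lemma X_sub L w : w \in X L -> w \in W.
Proof. by rewrite inE => /andP[]. Qed.

Lemma X_disjoint_gen L w :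
  L \subset S -> w \in X L -> [disjoint inv w & <<L>>].
Proof.
move=> sLS; rewrite inE => /andP[Ww /forall_inP minw].
rewrite disjoint_subset; apply/subsetP=> t wt; rewrite inE; apply/negP => Lt.
have Wt := cox_genW sLS Lt.
have := minw t Lt; rewrite !cox_lengthE ?groupM // leqNgt => /negP; apply.
have Sw : w \in S ^+ #|inv w| by rewrite reduced_word ?cox_gen.
apply: leq_ltn_trans (card_inv_leq (subxx S) (exchange (subxx S) Sw wt)) _.
by rewrite prednK //; apply/card_gt0P; exists t.
Qed.

Lemma lcoset_decomp L w : L \subset S -> w \in W ->
  exists2 a, a \in X L & exists2 u, u \in <<L>> & w = a * u.
Proof.
move=> sLS Ww; have w_in : w \in w *: <<L>> by exact: lcoset_refl.
case: (arg_minnP (cox_length S) w_in) => a /lcosetP[u Lu defa] mina.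
have Wa : a \in W by rewrite defa groupM // (cox_genW sLS).
exists a; last by exists u^-1; rewrite ?groupV // defa mulgK.
rewrite inE Wa; apply/forall_inP=> v Lv; apply: mina.
by rewrite topredE defa -mulgA mem_lcoset mulKg groupM.
Qed.

(** The last letter of a reduced word of v in L is an inversion of v, so only the empty word
    remains. *)
Lemma gen_disjoint_eq1 L v :
  L \subset S -> v \in <<L>> -> [disjoint inv v & L] -> v = 1.
Proof.
move=> sLS Lv disv; have := reduced_word sLS Lv.
case def_n: #|inv v| => [|n]; first by rewrite expg0 => /set1gP.
case/prod_setP=> w Lw [s Ls defv]; have Ss := subsetP sLS s Ls.
have := card_inv_up (cox_genW sLS Lv) Ss (negbT (disjointFl disv Ls)).
rewrite {1}defv cox_mulKs // def_n => le_n.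
by have := card_inv_leq sLS Lw; rewrite le_n ltnNge leqW.
Qed.

(** Write w = a v with a minimal and v in [<<L>>]. Since a has no inversion in [<<L>>], the
    inversions of v in L are inversions of w, and v is trivial when there are none. *)
Lemma mem_X L w : L \subset S -> w \in W ->
  (w \in X L) = [disjoint inv w & L].
Proof.
move=> sLS Ww; apply/idP/idP=> [/(X_disjoint_gen sLS)|disw].
  rewrite !disjoint_subset => /subset_trans; apply.
  by apply/subsetP => t; rewrite !inE; apply/contra/mem_gen.
have [a Xa [v Lv defw]] := lcoset_decomp sLS Ww.
suffices v1 : v = 1 by rewrite defw v1 mulg1.
apply: gen_disjoint_eq1 (Lv) _ => //; rewrite disjoint_sym disjoint_subset.
apply/subsetP=> s Ls; rewrite inE; apply/negP => vs.
have := disjointFl disw Ls; rewrite defw inv_mul ?(X_sub Xa) ?(cox_genW sLS) //.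
rewrite vs (disjointFl (X_disjoint_gen sLS Xa)) //.
by rewrite groupJr ?groupV // mem_gen.
Qed.

Lemma X_gen_eq1 L a v :
  L \subset S -> a \in X L -> v \in <<L>> -> a * v \in X L -> v = 1.
Proof.
move=> sLS Xa Lv Xav; apply: (gen_disjoint_eq1 sLS) => //.
rewrite disjoint_sym disjoint_subset.
apply/subsetP=> s Ls; rewrite inE; apply/negP => vs.
have Ls' : s ^ v^-1 \in <<L>> by rewrite groupJr ?groupV // mem_gen.
have := disjointFl (X_disjoint_gen sLS Xav) (mem_gen Ls).
rewrite inv_mul ?(X_sub Xa) ?(cox_genW sLS) // vs.
by rewrite (disjointFl (X_disjoint_gen sLS Xa)).
Qed.

Lemma lcoset_decomp_uniq L a a' u u' : L \subset S ->
  a \in X L -> a' \in X L -> u \in <<L>> -> u' \in <<L>> ->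
  a * u = a' * u' -> a = a' /\ u = u'.
Proof.
move=> sLS Xa Xa' Lu Lu' eq_au.
have defa' : a' = a * (u * u'^-1) by rewrite mulgA eq_au mulgK.
have v1 : u * u'^-1 = 1.
  by apply: X_gen_eq1 sLS Xa _ _; rewrite ?groupM ?groupV // -defa'.
by rewrite defa' v1 mulg1; split=> //; apply/eqP; rewrite eq_mulgV1 v1.
Qed.

Lemma gen_capS L s : L \subset S -> s \in S -> s \in <<L>> -> s \in L.
Proof.
move=> sLS Ss Ls; apply: contraT => nLs.
have s1 : s = 1.
  apply: gen_disjoint_eq1 Ls _ => //; rewrite inv_s // disjoint_subset.
  by apply/subsetP=> t /set1P->.
by case: coxWS => _ /(_ s Ss); rewrite s1 order1.
Qed.

(** An element of [<<L>>] with the most inversions must have every s in L as an inversion. It serves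
    to test linear independence in [x_free]. *)
Lemma longest_elt L : L \subset S ->
  exists2 w, w \in W & {in S, forall s, (s \in inv w) = (s \in L)}.
Proof.
move=> sLS; case: (arg_maxnP (fun w => #|inv w|) (group1 <<L>>)) => w Lw maxw.
have {}Lw : w \in <<L>> := Lw.
exists w => [|s Ss]; first exact: cox_genW Lw.
apply/idP/idP => [/(subsetP (inv_gen sLS Lw))|Ls]; first exact: gen_capS.
apply: contraT => /(card_inv_up (cox_genW sLS Lw) Ss) eq_n.
have Lws : w * s \in <<L>> by rewrite groupM // mem_gen.
by have := maxw _ Lws; rewrite /= eq_n ltnn.
Qed.

Lemma XS : X S = [set 1].
Proof.
apply/setP=> w; apply/idP/set1P => [Xw|->].
  have Ww := X_sub Xw; apply: (gen_disjoint_eq1 (subxx S)).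
    by rewrite cox_gen.
  by rewrite -mem_X.
by rewrite mem_X // inv1 disjoint_subset; apply/subsetP=> t; rewrite inE.
Qed.

(** * Double cosets and intersections of parabolic subgroups *)

Lemma dcoset_conj_gen J K d k : J \subset S -> K \subset S ->
  d^-1 \in X J -> d \in X K -> k \in K -> k ^ d^-1 \in <<J>> -> k ^ d^-1 \in J.
Proof.
move=> sJS sKS XdV Xd Kk Ju; set u := k ^ d^-1.
have [[Wd Wu] Sk] := (X_sub Xd, cox_genW sJS Ju, subsetP sKS k Kk).
have defdk : d * k = u * d by rewrite /u conjgE invgK !mulgA mulgKV.
(* The length of d k = u d is that of d plus 1, and also that of d plus that of u; hence u has
   length 1. *)
have : #|inv (d * k)| = #|inv d|.+1.
  apply: card_inv_up => //; apply/negP => /(disjointFr (X_disjoint_gen sKS Xd)).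
  by rewrite mem_gen.
have Wdk : d * k \in W by rewrite groupM // cox_mem.
rewrite defdk -card_inv_V -?defdk // defdk invMg.
rewrite (card_inv_mul sJS) ?groupV ?X_disjoint_gen // !card_inv_V //.
rewrite -addn1 => /addnI n1.
by have := reduced_word sJS Ju; rewrite n1 expg1.
Qed.

Lemma dcoset_conj_sub J K d : J \subset S -> K \subset S ->
  d^-1 \in X J -> K :^ d^-1 \subset <<J>> -> d \in X K /\ K \subset J :^ d.
Proof.
move=> sJS sKS XdV sKJ.
have Jk k : k \in K -> k ^ d^-1 \in <<J>>.
  by move=> Kk; rewrite (subsetP sKJ) // memJ_conjg.
have Wd : d \in W by rewrite -groupV (X_sub XdV).
have Xd : d \in X K.
  rewrite mem_X // disjoint_sym disjoint_subset; apply/subsetP=> k Kk.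
  rewrite inE; apply/negP => dk; have Sk := subsetP sKS k Kk.
  have /eqP := card_inv_down Wd Sk dk; apply/negP.
  have -> : d * k = k ^ d^-1 * d by rewrite conjgE invgK !mulgA mulgKV.
  have Ju := Jk k Kk; have Wu := cox_genW sJS Ju.
  rewrite -(card_inv_V (groupM Wu Wd)) invMg.
  rewrite (card_inv_mul sJS) ?groupV ?X_disjoint_gen // card_inv_V //.
  by rewrite ltn_eqF // ltnS leq_addr.
split=> //; apply/subsetP=> k Kk; rewrite mem_conjg.
by apply: (dcoset_conj_gen sJS sKS) => //; apply: Jk.
Qed.

(** Induction on the length of v in [<<K>>]: if s in K is an inversion of v, it is one of d v = u d,
    so its conjugate by d^-1 is an inversion of u. This conjugate lies in [<<J>>], hence in J, and s
    can be split off. *)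
Lemma dcoset_inter J K d : J \subset S -> K \subset S ->
  d^-1 \in X J -> d \in X K ->
  <<J>> :&: <<K>> :^ d^-1 = <<J :&: K :^ d^-1>>.
Proof.
move=> sJS sKS XdV Xd; apply/eqP; rewrite eqEsubset.
apply/andP; split; last first.
  by rewrite -genJ subsetI !genS ?subsetIl ?subsetIr.
have Wd := X_sub Xd.
suffices main n v : #|inv v| <= n -> v \in <<K>> -> v ^ d^-1 \in <<J>> ->
    v ^ d^-1 \in <<J :&: K :^ d^-1>>.
  apply/subsetP=> u /setIP[Ju]; rewrite mem_conjg invgK => Kv.
  by rewrite -(conjgK d u) (main _ _ (leqnn _)) // conjgK.
elim: n v => [|n IHn] v le_v_n Kv Ju.
  suffices -> : v = 1 by rewrite conj1g group1.
  by have := reduced_word sKS Kv; move: le_v_n; case: #|_| => // _ /set1gP.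
have [disv|] := boolP [disjoint inv v & K].
  by rewrite (gen_disjoint_eq1 sKS Kv disv) conj1g group1.
case/pred0Pn=> s /andP[/= vs Ks]; have Ss := subsetP sKS s Ks.
set u := v ^ d^-1 in Ju *.
have [Wu Wv] := (cox_genW sJS Ju, cox_genW sKS Kv).
have defdv : d * v = u * d by rewrite /u conjgE invgK !mulgA mulgKV.
have Kd t : t \in <<K>> -> (t \in inv d) = false.
  by move=> Kt; rewrite (disjointFl (X_disjoint_gen sKS Xd)).
have us : s ^ d^-1 \in inv u.
  have : s \in inv (d * v).
    by rewrite inv_mul // vs Kd // groupJr ?groupV // mem_gen.
  by rewrite defdv inv_mul // Kd ?mem_gen.
have Jj := subsetP (inv_gen sJS Ju) _ us.
have Jj' := dcoset_conj_gen sJS sKS XdV Xd Ks Jj.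
have Kvs : v * s \in <<K>> by rewrite groupM // mem_gen.
have := card_inv_down Wv Ss vs => eq_n.
rewrite /u -(cox_mulKs v Ss) conjMg groupM //.
  by apply: IHn; [rewrite -ltnS -eq_n|by []|rewrite conjMg groupM].
by rewrite mem_gen // inE Jj' memJ_conjg.
Qed.

Lemma dcoset_min J K g : J \subset S -> K \subset S -> g \in W ->
  exists u, exists2 v, u \in <<J>> /\ v \in <<K>> &
    (u * g * v)^-1 \in X J /\ u * g * v \in X K.
Proof.
move=> sJS sKS Wg.
have g_in : g \in <<J>> :* g * <<K>>.
  by apply/mulsgP; exists g 1; rewrite ?mulg1 ?rcoset_refl.
case: (arg_minnP (cox_length S) g_in) => d.
move=> /mulsgP[_ v /rcosetP[u Ju ->] Kv defd] mind.
have Wd : d \in W.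
  by rewrite defd !groupM // ?(cox_genW sJS Ju) // (cox_genW sKS Kv).
exists u; exists v => //; rewrite -defd; split.
  rewrite inE groupV Wd; apply/forall_inP=> w Jw.
  have Ww := cox_genW sJS Jw.
  rewrite !cox_lengthE ?groupM ?groupV // -[w]invgK -invMg.
  rewrite !card_inv_V ?groupM ?groupV // -!cox_lengthE ?groupM ?groupV //.
  apply: mind; rewrite topredE defd !mulgA; apply/mulsgP.
  exists (w^-1 * u * g) v => //.
  by apply/rcosetP; exists (w^-1 * u); rewrite // groupM ?groupV.
rewrite inE Wd; apply/forall_inP=> w Kw; apply: mind.
rewrite topredE defd -mulgA; apply/mulsgP; exists (u * g) (v * w) => //.
  by apply/rcosetP; exists u.
by rewrite groupM.
Qed.

Lemma parabolic_inter J K g : J \subset S -> K \subset S -> g \in W ->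
  exists u, exists2 d, u \in <<J>> /\ d \in W &
    <<J>> :&: <<K>> :^ g = <<J :&: K :^ d>> :^ u.
Proof.
move=> sJS sKS Wg.
have [u [v [Ju Kv] [XdV Xd]]] := dcoset_min sJS sKS (groupVr Wg).
have := dcoset_inter sJS sKS XdV Xd.
set d := u * g^-1 * v in XdV Xd * => eqI.
have Wd := X_sub Xd.
exists u; exists d^-1; rewrite ?groupV // -eqI conjIg.
rewrite (normsP (normG <<J>>)) // -conjsgM.
have defg : v^-1 * g = d^-1 * u by rewrite /d !invMg invgK !mulgA mulgKV.
by rewrite -defg conjsgM (normsP (normG <<K>>) v^-1) // groupV.
Qed.

(** Intersecting with [<<K>>] shows that [<<K>>] is generated by K :&: J :^ d for some d, and the
    only elements of S in that subgroup are those of the set itself. *)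
Lemma gen_sub_conj J K g : J \subset S -> K \subset S -> g \in W ->
  <<K>> \subset <<J>> :^ g -> exists2 d, d \in W & K \subset J :^ d.
Proof.
move=> sJS sKS Wg sKJ; have [u [d [Ku Wd]]] := parabolic_inter sKS sJS Wg.
rewrite (setIidPl sKJ) => /(congr1 (fun A : {set gT} => A :^ u^-1)).
rewrite (normsP (normG <<K>>)) ?groupV // conjsgK => eqK.
exists d => //; apply/subsetP=> k Kk.
have sLS : K :&: J :^ d \subset S by rewrite subIset ?sKS.
have := gen_capS sLS (subsetP sKS k Kk); rewrite -eqK mem_gen // => /(_ isT).
by case/setIP.
Qed.

Lemma gen_conj_conj J K g h :
  J \subset S -> K \subset S -> g \in W -> h \in W ->
  <<K>> \subset <<J>> :^ g -> <<J>> \subset <<K>> :^ h ->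
  exists2 d, d \in W & K = J :^ d.
Proof.
move=> sJS sKS Wg Wh /(gen_sub_conj sJS sKS Wg)[d Wd sKJ].
case/(gen_sub_conj sKS sJS Wh)=> e We sJK; exists d => //.
apply/eqP; rewrite eqEcard sKJ cardJg -(cardJg K e).
exact: subset_leq_card.
Qed.

(** * Solomon's product formula *)

Lemma sum_lcoset_decomp (V : nmodType) L (F : gT -> V) : L \subset S ->
  (\sum_(w in W) F w = \sum_(a in X L) \sum_(u in <<L>>) F (a * u)%g)%R.
Proof.
move=> sLS; rewrite pair_big_dep /=.
rewrite -(@big_imset _ _ _ _ _ (fun p : gT * gT => p.1 * p.2)
           [pred p | (p.1 \in X L) && (p.2 \in <<L>>)] F) /=.
  apply: eq_bigl => w; apply/idP/imsetP => [Ww|[[a u] /andP[/= Xa Lu] ->]].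
    have [a Xa [u Lu ->]] := lcoset_decomp sLS Ww.
    by exists (a, u); rewrite // inE /= Xa.
  by rewrite groupM ?(X_sub Xa) ?(cox_genW sLS).
move=> [a u] [a' u'] /andP[/= Xa Lu] /andP[/= Xa' Lu'].
by case/(lcoset_decomp_uniq sLS Xa Xa' Lu Lu') => -> ->.
Qed.

Lemma sum_rcoset_decomp (V : nmodType) L (F : gT -> V) : L \subset S ->
  (\sum_(w in W) F w =
     \sum_(d | (d^-1 \in X L)%g) \sum_(u in <<L>>) F (u * d)%g)%R.
Proof.
move=> sLS; rewrite (reindex_inj invg_inj) /=.
rewrite (eq_bigl (fun w => w \in W)) => [|w]; last by rewrite groupV.
rewrite (sum_lcoset_decomp _ sLS) (reindex_inj invg_inj) /=.
apply: eq_bigr => d _; rewrite (reindex_inj invg_inj) /=.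
apply: eq_big => u; first by rewrite groupV.
by rewrite -invMg invgK.
Qed.

(* Write b = u d with u in <<J>> and d^-1 in X J, then both conditions say    *)
(* that no k in K with k^(d^-1) in J makes k^(d^-1) an inversion of u.        *)
Lemma solomon_descent J K a u d : J \subset S -> K \subset S ->
  a \in X J -> u \in <<J>> -> d^-1 \in X J -> d \in X K ->
  (u * d \in X K) = (a * u * d \in X (J :^ d :&: K)).
Proof.
move=> sJS sKS Xa Ju XdV Xd.
have sLS : J :^ d :&: K \subset S by rewrite subIset // sKS orbT.
have [[Wa Wu] Wd] := (X_sub Xa, cox_genW sJS Ju, X_sub Xd).
rewrite !mem_X ?groupM //.
have Kd k : k \in K -> (k \in inv d) = false.
  by move=> Kk; rewrite (disjointFl (X_disjoint_gen sKS Xd)) ?mem_gen.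
have in_aud k : k \in J :^ d :&: K ->
    (k \in inv (a * u * d)) = (k \in inv (u * d)).
  case/setIP=> Jk Kk; rewrite !inv_mul ?groupM // Kd //=.
  rewrite (disjointFl (X_disjoint_gen sJS Xa)) ?addbF //.
  by rewrite groupJr ?groupV // mem_gen // -mem_conjg.
rewrite ![[disjoint inv _ & _]]disjoint_sym !disjoint_subset.
apply/subsetP/subsetP => sub k Kk; rewrite inE; apply/negP => uk.
  move: uk; rewrite in_aud //; apply/negP; apply: sub.
  by case/setIP: Kk.
have Jk : k ^ d^-1 \in <<J>>.
  apply: (subsetP (inv_gen sJS Ju)).
  by move: uk; rewrite inv_mul // Kd.
have Lk : k \in J :^ d :&: K.
  by rewrite inE Kk andbT mem_conjg (dcoset_conj_gen sJS sKS).
by have := sub k Lk; rewrite inE in_aud // uk.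
Qed.

Lemma solomon_sum (V : nmodType) J K (F : gT -> V) :
  J \subset S -> K \subset S ->
  (\sum_(a in X J) \sum_(b in X K) F (a * b)%g =
   \sum_(d | (d^-1 \in X J)%g && (d \in X K))
     \sum_(w in X (J :^ d :&: K)) F w)%R.
Proof.
move=> sJS sKS.
have XE L (G : gT -> V) :
    (\sum_(w in X L) G w = \sum_(w in W) if w \in X L then G w else 0)%R.
  rewrite -big_mkcondr; apply: eq_bigl => w.
  by apply/idP/andP => [Xw|[]//]; rewrite (X_sub Xw).
transitivity (\sum_(d | (d^-1 \in X J)%g) \sum_(a in X J) \sum_(u in <<J>>)
    if (u * d \in X K)%g then F (a * u * d)%g else 0)%R.
  rewrite [RHS]exchange_big; apply: eq_bigr => a Xa.
  rewrite XE (sum_rcoset_decomp _ sJS).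
  by do 2![apply: eq_bigr => ? _]; rewrite mulgA.
rewrite big_mkcondr; apply: eq_bigr => d XdV.
(* If some k in K is an inversion of d, it stays an inversion of u d for all u in [<<J>>], so such a
   d contributes nothing. *)
case: ifPn => [Xd|nXd]; last first.
  apply: big1 => a _; apply: big1 => u Ju; case: ifP => // Xud; case/negP: nXd.
  have Wd : d \in W by rewrite -groupV (X_sub XdV).
  have Wu := cox_genW sJS Ju.
  rewrite mem_X // disjoint_sym disjoint_subset; apply/subsetP=> k Kk.
  rewrite inE; apply/negP => dk.
  have JVk : (k ^ d^-1 \in inv u) = false.
    apply/negP => /(subsetP (inv_gen sJS Ju)).
    by rewrite (disjointFr (X_disjoint_gen sJS XdV)) // inv_V // conjgKV.
  have := disjointFl (X_disjoint_gen sKS Xud) (mem_gen Kk).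
  by rewrite inv_mul // dk JVk.
have Wd := X_sub Xd.
rewrite [RHS]XE [RHS](reindex_inj (mulIg d)) /=.
rewrite [RHS](eq_bigl (fun w => w \in W)) => [|w]; last by rewrite groupMr.
rewrite [RHS](sum_lcoset_decomp _ sJS); apply: eq_bigr => a Xa.
by apply: eq_bigr => u Ju; rewrite (solomon_descent sJS sKS Xa).
Qed.

(** * Marks *)

Local Notation fixed J Q := 'Fix_(rcosets <<J>> W | 'Rs)(Q).

(** Inversion turns left cosets into right cosets, on which the action ['Rs] is available. *)
Lemma card_fixed J K : mark W J K = #|fixed J <<K>>|.
Proof.
rewrite /mark -card_invg; apply: eq_card => C.
rewrite mem_invg !inE -mem_invg invg_lcosets !invGid; congr (_ && _).
have fixE u : (u *: C^-1 == C^-1) = (C :* u^-1 == C).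
  by rewrite -(inj_eq invg_inj) !invMg !invgK invg_set1.
apply/forall_inP/subsetP => fixC u Ku.
  by rewrite inE /= rcosetE -[u]invgK -fixE fixC ?groupV.
by have := fixC u^-1; rewrite inE /= rcosetE -fixE groupV => ->.
Qed.

Lemma fixedP J (Q C : {set gT}) :
  reflect (exists2 x, x \in W & Q \subset <<J>> :^ x /\ C = <<J>> :* x)
          (C \in fixed J Q).
Proof.
apply: (iffP setIP) => [[/rcosetsP[x Wx ->]]|[x Wx [sQJ ->]]].
  by rewrite sub_afixRs_norms; exists x.
by rewrite sub_afixRs_norms; split=> //; apply/rcosetsP; exists x.
Qed.

Lemma mark_pos J K : J \subset S ->
  reflect (exists2 g, g \in W & <<K>> \subset <<J>> :^ g) (0 < mark W J K).
Proof.
move=> sJS; rewrite card_fixed; apply: (iffP card_gt0P) => [[C]|[g Wg sKJ]].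
  by case/fixedP=> x Wx [sKJ _]; exists x.
by exists (<<J>> :* g); apply/fixedP; exists g.
Qed.

Lemma mark_diag J : J \subset S -> mark W J J = #|'N_W(<<J>>) : <<J>>|.
Proof. by move=> sJS; rewrite card_fixed afixRs_rcosets. Qed.

Lemma mark_diag_gt0 J : J \subset S -> 0 < mark W J J.
Proof. by move=> sJS; rewrite mark_diag. Qed.

Lemma card_fixed_conj J (Q : {set gT}) w : w \in W ->
  #|fixed J (Q :^ w)| = #|fixed J Q|.
Proof.
move=> Ww; rewrite -(card_imset (mem (fixed J Q)) (act_inj 'Rs w)).
apply: eq_card => C; apply/fixedP/imsetP => [[x Wx [sQJ ->]]|[D]].
  exists (<<J>> :* (x * w^-1)).
    apply/fixedP; exists (x * w^-1); first by rewrite groupM ?groupV.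
    by rewrite conjsgM -sub_conjg.
  by rewrite /= rcosetE -rcosetM mulgKV.
case/fixedP=> x Wx [sQJ ->] ->; exists (x * w); first by rewrite groupM.
by rewrite conjsgM conjSg /= rcosetE -rcosetM.
Qed.

Lemma mark_conjr J K w : w \in W -> mark W J (K :^ w) = mark W J K.
Proof. by move=> Ww; rewrite !card_fixed genJ card_fixed_conj. Qed.

(** A fixed coset contains exactly one d with d^-1 in X J, and fixity puts the conjugate of K by
    d^-1 inside [<<J>>]; [dcoset_conj_sub] then gives the two remaining conditions on d. *)
Lemma mark_Solomon J K : J \subset S -> K \subset S ->
  mark W J K =
    #|[set d | (d^-1 \in X J) && (d \in X K) & J :^ d :&: K == K]|.
Proof.
move=> sJS sKS; rewrite card_fixed; set D := [set d | _].
have inD d : (d \in D) =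
    [&& d^-1 \in X J, d \in X K & J :^ d :&: K == K].
  by rewrite /D in_set -andbA.
have injD : {in D &, injective (rcoset <<J>>)}.
  move=> d e; rewrite !inD !rcosetE => /andP[XdV _] /andP[XeV _] eq_de.
  have : d \in <<J>> :* e by rewrite -eq_de rcoset_refl.
  case/rcosetP=> u Ju defd.
  have [] := lcoset_decomp_uniq sJS XdV XeV (group1 _) (groupVr Ju).
    by rewrite defd invMg mulg1.
  by move=> /invg_inj.
rewrite -(card_in_imset injD); apply: eq_card => C.
apply/fixedP/imsetP => [[x Wx [sKJ ->]]|[d]].
  have [a Xa [u Ju defx]] := lcoset_decomp sJS (groupVr Wx).
  have eqC : <<J>> :* x = <<J>> :* a^-1.
    by apply/rcoset_eqP; rewrite mem_rcoset invgK -[x]invgK defx invMg mulgKV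
      groupV.
  have sKJa : K :^ a \subset <<J>>.
    rewrite sub_conjg -(normsP (normG <<J>>) _ (groupVr Ju)) -conjsgM.
    by rewrite -invMg -defx invgK (subset_trans (subset_gen K)).
  exists a^-1; last by rewrite rcosetE.
  rewrite -[a]invgK in Xa sKJa.
  have [Xd sKJd] := dcoset_conj_sub sJS sKS Xa sKJa.
  by rewrite inD Xa Xd /=; apply/eqP/setIidPr.
rewrite inD rcosetE => /and3P[XdV Xd /eqP/setIidPr sKJ] ->.
exists d; first exact: X_sub Xd.
by rewrite -genJ genS.
Qed.

(** A smallest parabolic subgroup containing Q lies in every other one, because the intersection of
    the two is again parabolic. *)
Lemma parabolic_closure (Q : {set gT}) : Q \subset W ->
  exists L, exists2 w, L \subset S /\ w \in W & Q \subset <<L>> :^ w /\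
    forall J x, J \subset S -> x \in W ->
      (Q \subset <<J>> :^ x) = (<<L>> :^ w \subset <<J>> :^ x).
Proof.
move=> sQW.
pose P (c : {set gT} * gT) :=
  [&& c.1 \subset S, c.2 \in W & Q \subset <<c.1>> :^ c.2].
have PS : P (S, 1) by rewrite /P /= subxx group1 conjsg1 cox_gen.
case: (arg_minnP (fun c : {set gT} * gT => #|<<c.1>>|) PS) => -[L w].
case/and3P=> /= sLS Ww sQL minL; exists L; exists w => //.
split=> // J x sJS Wx.
apply/idP/idP => [sQJ|]; last exact: subset_trans.
have Wxw : x * w^-1 \in W by rewrite groupM ?groupV.
have [u [d [Lu Wd]]] := parabolic_inter sLS sJS Wxw.
move/(congr1 (fun A : {set gT} => A :^ w)).
rewrite conjIg -!conjsgM mulgKV => eqI.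
have sMS : L :&: J :^ d \subset S by rewrite subIset // sLS.
have Wu := cox_genW sLS Lu.
have := minL (L :&: J :^ d, u * w).
rewrite /P /= sMS groupM // -eqI subsetI sQL sQJ => /(_ isT) le_L.
suffices /eqP <- : <<L>> :^ w :&: <<J>> :^ x == <<L>> :^ w by apply: subsetIr.
by rewrite eqEcard subsetIl cardJg (leq_trans le_L) // eqI cardJg.
Qed.

(** * Columns of marks modulo p *)

Variable p : nat.
Hypothesis p_pr : prime p.

Lemma mark_mod_step K : K \subset S -> p %| #|'N_W(<<K>>) : <<K>>| ->
  exists2 L : {set gT}, L \subset S /\ #|<<K>>| < #|<<L>>| &
    forall J, J \subset S -> mark W J K = mark W J L %[mod p].
Proof.
move=> sKS p_dv; have sKW := cox_sub sKS.
have [P sylP] := Sylow_exists p 'N_W(<<K>>).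
have sPN := pHall_sub sylP; have sPW := subset_trans sPN (subsetIl _ _).
have nKP := subset_trans sPN (subsetIr _ _).
have sKN : <<K>> \subset 'N_W(<<K>>) by rewrite subsetI sKW normG.
(* A Sylow subgroup inside [<<K>>] would make the index prime to p. *)
have nsPK : ~~ (P \subset <<K>>).
  apply/negP => sPK; have /and3P[_ _] := sylP; rewrite p'natE //.
  by rewrite -(Lagrange_index sKN sPK) dvdn_mulr.
have sQW : <<K>> <*> P \subset W by rewrite join_subG sKW.
have [L [w [sLS Ww] [sQL clL]]] := parabolic_closure sQW.
exists L; first split=> //.
  rewrite -(cardJg <<L>> w) (leq_trans _ (subset_leq_card sQL)) //.
  apply: proper_card; rewrite properEneq joing_subl andbT.
  by apply: contra nsPK => /eqP->; apply: joing_subr.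
move=> J sJS; rewrite !card_fixed -(card_fixed_conj J <<L>> Ww).
have -> : fixed J (<<L>> :^ w) = fixed J (<<K>> <*> P).
  apply/setP=> C; apply/fixedP/fixedP => -[x Wx [sJ ->]]; exists x => //.
    by rewrite clL.
  by rewrite -clL.
(* The fixed points of the join are those of P on the fixed points of [<<K>>], which P permutes
   because it normalizes [<<K>>]. *)
rewrite [in RHS]afix_gen afixU setIA.
apply: pgroup_fix_mod; first exact: pHall_pgroup sylP.
apply: actsI; last exact: acts_fix_norm.
by apply: subset_trans (actsRs_rcosets _ _).
Qed.

(** Iterate [mark_mod_step]: the order of [<<K>>] grows at each step and is bounded by that of W. *)
Lemma mark_mod_rep K : K \subset S ->
  exists2 L : {set gT}, L \subset S /\ ~~ (p %| #|'N_W(<<L>>) : <<L>>|) &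
    forall J, J \subset S -> mark W J K = mark W J L %[mod p].
Proof.
have [n] := ubnP (#|W| - #|<<K>>|); elim: n K => // n IHn K le_n sKS.
have [p_dv|] := boolP (p %| #|'N_W(<<K>>) : <<K>>|); last by exists K.
have [L [sLS ltKL] eqL] := mark_mod_step sKS p_dv.
have [|//|M nM eqM] := IHn L.
  rewrite -ltnS (leq_trans _ le_n) // ltnS ltn_sub2l //.
  by rewrite (leq_trans ltKL) // subset_leq_card // cox_sub.
by exists M => // J sJS; rewrite eqL // eqM.
Qed.

(** * The descent algebra *)

Local Open Scope ring_scope.

Local Notation x := (x_elt W S).

Definition solomon_coef J K L : nat :=
  #|[set d | (d^-1%g \in X J) && (d \in X K) & J :^ d :&: K == L]|.

Lemma x_S : x S = 1%:M.
Proof. by rewrite /x_elt XS /gset_mx big_set1 repr_mx1. Qed.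

Lemma x_mul J K : J \subset S -> K \subset S ->
  x J *m x K = \sum_(L : {set gT} | L \subset K) x L *+ solomon_coef J K L.
Proof.
move=> sJS sKS; rewrite /x_elt {1 2}/gset_mx mulmx_suml.
transitivity (\sum_(a in X J) \sum_(b in X K) regular_repr rat W (a * b)%g).
  apply: eq_bigr => a Xa; rewrite mulmx_sumr; apply: eq_bigr => b Xb.
  by rewrite repr_mxM ?(X_sub Xa) ?(X_sub Xb).
rewrite solomon_sum //.
rewrite (partition_big (fun d => J :^ d :&: K)
  (fun L : {set gT} => L \subset K)) => [|d _]; last exact: subsetIr.
apply: eq_bigr => L _.
rewrite (eq_bigr (fun=> x L)) => [|d /andP[_ /eqP->] //].
by rewrite sumr_const /solomon_coef cardsE.
Qed.

Lemma x_coef L w : w \in W ->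
  gring_row (x L) 0 (gring_index W w) = (w \in X L)%:R.
Proof.
move=> Ww; rewrite /x_elt /gset_mx linear_sum summxE.
have regE v : v \in W ->
    gring_row (regular_repr rat W v) 0 (gring_index W w) = (v == w)%:R.
  move=> Wv; rewrite /gring_row /= /regular_mx 2!mxE.
  rewrite gring_indexK // mul1g mxE eqxx /= eq_sym.
  by congr (_%:R); rewrite -(inj_in_eq (can_in_inj (@gring_indexK _ W))).
transitivity (\sum_(v in X L) (v == w)%:R : rat).
  by apply: eq_bigr => v Xv; rewrite regE // (X_sub Xv).
have [Xw|nXw] := boolP (w \in X L).
  rewrite (bigD1 w) //= eqxx big1 ?addr0 // => v /andP[_ /negPf->] //.
by rewrite big1 // => v Xv; case: eqP nXw => // <- /negP[].
Qed.

(** The longest element of the subgroup generated by S :\: K lies in X L exactly when L \subset K.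
    Its coefficient in the sum is thus the sum of the c L with L \subset K, and induction on #|K|
    isolates c K. *)
Lemma x_free (c : {set gT} -> rat) :
  \sum_(L : {set gT} | L \subset S) c L *: x L = 0 ->
  forall K, K \subset S -> c K = 0.
Proof.
move=> sum0 K; have [n] := ubnP #|K|; elim: n K => // n IHn K leKn sKS.
have sCS : S :\: K \subset S by apply: subsetDl.
have [w Ww invw] := longest_elt sCS.
have Xw L : L \subset S -> (w \in X L) = (L \subset K).
  move=> sLS; rewrite mem_X // disjoint_sym disjoint_subset.
  apply/subsetP/subsetP => sub s Ls; have Ss := subsetP sLS s Ls.
    by have := sub s Ls; rewrite inE invw // inE Ss andbT negbK.
  by rewrite inE invw // inE Ss andbT negbK sub.
move/(congr1 (fun M => gring_row M 0 (gring_index W w))): sum0.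
rewrite linear_sum summxE linear0 mxE (bigD1 K) //= linearZ mxE x_coef // Xw //.
rewrite subxx mulr1 big1 ?addr0 // => L /andP[sLS neqLK].
rewrite linearZ mxE x_coef // Xw //.
have [sLK|] := boolP (L \subset K); last by rewrite mulr0.
rewrite IHn ?mul0r // -ltnS (leq_trans _ leKn) // ltnS proper_card //.
by rewrite properEneq neqLK.
Qed.

Let basis := [tuple of [seq x L | L in powerset S]].
Let S_in : S \in powerset S. Proof. by rewrite inE. Qed.
Let idx L : 'I_#|powerset S| := enum_rank_in S_in L.

Lemma basis_nth (i : 'I_#|powerset S|) : basis`_i = x (enum_val i).
Proof. by rewrite /= nth_image. Qed.

Lemma basis_free : free basis.
Proof.
apply/freeP=> k sum0 i.
pose c L := k (idx L).
have sub_val (j : 'I_#|powerset S|) : enum_val j \subset S.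
  by have := enum_valP j; rewrite inE.
have <- : c (enum_val i) = k i by rewrite /c /idx enum_valK_in.
apply: x_free (sub_val i); rewrite -[RHS]sum0.
rewrite (eq_bigl (mem (powerset S))) => [|L]; last by rewrite /= inE.
rewrite big_enum_val /=; apply: eq_bigr => j _.
by rewrite basis_nth /c /idx enum_valK_in.
Qed.

Definition x_coord K : {linear 'M[rat]_#|W| -> rat^o} := coord basis (idx K).

Lemma x_coordE K L : K \subset S -> L \subset S ->
  x_coord K (x L) = (L == K)%:R.
Proof.
move=> sKS sLS.
have inS (M : {set gT}) : M \subset S -> M \in powerset S by rewrite inE.
rewrite -[in x L](enum_rankK_in S_in (inS L sLS)) -basis_nth.
rewrite [LHS](coord_free (idx L) (idx K) basis_free); congr (_%:R).
by rewrite (inj_in_eq (can_in_inj (enum_rankK_in S_in))) // inS.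
Qed.

Lemma descent_spanP (b : 'M[rat]_#|W|) :
  b \in descent_space W S ->
  exists c : {set gT} -> rat, b = \sum_(L : {set gT} | L \subset S) c L *: x L.
Proof.
move/(coord_span (X := basis)) => defb.
exists (fun L => x_coord L b); rewrite [LHS]defb.
rewrite [RHS](eq_bigl (mem (powerset S))) => [|L]; last by rewrite /= inE.
rewrite [RHS]big_enum_val; apply: eq_bigr => j _.
by rewrite basis_nth /x_coord /idx enum_valK_in.
Qed.

(* The x_L with L \subset K span a left ideal, on whose quotient by the span  *)
(* of those with L \proper K the algebra acts by the character x_char K.      *)
Definition x_char K : {linear 'M[rat]_#|W| -> rat^o} :=
  x_coord K \o mulmxr (x K).

Lemma x_charE J K : J \subset S -> K \subset S ->
  x_char K (x J) = (mark W J K)%:R.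
Proof.
move=> sJS sKS; rewrite /= x_mul // linear_sum (bigD1 K) //= big1 => [|L].
  by rewrite addr0 linearMn /= x_coordE // eqxx mark_Solomon.
case/andP=> sLK neqLK; rewrite linearMn /= x_coordE ?(subset_trans sLK) //.
by rewrite (negPf neqLK) mul0rn.
Qed.

Lemma x_char1 K : K \subset S -> x_char K 1%:M = 1.
Proof. by move=> sKS; rewrite /= mul1mx x_coordE ?eqxx. Qed.

Lemma x_charM K (a b : 'M[rat]_#|W|) : K \subset S ->
  a \in descent_space W S -> b \in descent_space W S ->
  x_char K (a *m b) = x_char K a * x_char K b.
Proof.
move=> sKS Da Db.
(* U is stable under left multiplication by the algebra and killed by the K-th coordinate; modulo U,
   each element c sends x K to [x_char K c] times x K. *)
pose U := (\sum_(L : {set gT} | L \proper K) <[x L]>)%VS.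
have xU L : L \proper K -> x L \in U.
  by move=> ltLK; rewrite memvE (sumv_sup L).
have U0 (r : 'M[rat]_#|W|) : r \in U -> x_coord K r = 0.
  case/memv_sumP=> y yU ->; rewrite linear_sum big1 // => L ltLK.
  have /vlineP[k ->] := yU L ltLK.
  rewrite linearZ /= x_coordE ?(subset_trans (proper_sub ltLK)) //.
  by rewrite (negPf (proper_neq ltLK)) scaler0.
have actU (c r : 'M[rat]_#|W|) :
      c \in descent_space W S -> r \in U -> c *m r \in U.
  move=> /descent_spanP[k ->] /memv_sumP[y yU ->].
  rewrite mulmx_suml memv_suml // => J sJS.
  rewrite mulmx_sumr memv_suml // => L ltLK; have /vlineP[h ->] := yU L ltLK.
  rewrite -scalemxAl -scalemxAr !memvZ // x_mul //; last first.
    exact: subset_trans (proper_sub ltLK) sKS.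
  rewrite memv_suml // => M sML.
  by rewrite rpredMn // xU // (sub_proper_trans sML).
have actx (c : 'M[rat]_#|W|) : c \in descent_space W S ->
    c *m x K - x_char K c *: x K \in U.
  case/descent_spanP=> k ->.
  rewrite [x_char K _]linear_sum mulmx_suml scaler_suml -sumrB memv_suml //.
  move=> J sJS; rewrite [x_char K _]linearZ x_charE // -scalemxAl.
  rewrite -[X in _ - X *: _]/(k J * (mark W J K)%:R) -scalerA -scalerBr.
  rewrite memvZ //.
  rewrite x_mul // (bigD1 K) //= scaler_nat mark_Solomon // addrAC subrr add0r.
  rewrite memv_suml // => L /andP[sLK neqLK].
  by rewrite rpredMn // xU // properEneq neqLK.
rewrite {1}/x_char /= -mulmxA.
rewrite -[b *m x K in LHS](subrK (x_char K b *: x K)) mulmxDr linearD /=.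
rewrite U0 ?actU ?actx // add0r -scalemxAr linearZ /=.
by rewrite mulrC.
Qed.

Arguments x_char K : simpl never.

(** * Class representatives and irreducible representations over Q *)

Section Representatives.

Variable E : {set {set gT}}.
Hypothesis repsE : subset_class_reps W S E.

Lemma reps_sub K : K \in E -> K \subset S.
Proof. by case/and3P: repsE => _ /subsetP sES _ /sES; rewrite inE. Qed.

Lemma reps_class K : K \subset S -> exists L,
  E :&: [set M in powerset S | [exists w in W, M == K :^ w]%g] = [set L].
Proof.
move=> sKS; case/and3P: repsE => _ _ /forall_inP oneE.
by apply/cards1P/oneE/imsetP; exists K; rewrite ?inE.
Qed.

Lemma reps_exists K : K \subset S ->
  exists2 L, L \in E & exists2 w, w \in W & L = (K :^ w)%g.
Proof.
case/reps_class=> L /setP/(_ L); rewrite in_set1 eqxx !inE.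
by case/and3P=> EL _ /exists_inP[w Ww /eqP]; exists L => //; exists w.
Qed.

Lemma reps_inj K L w : K \in E -> L \in E -> w \in W -> L = (K :^ w)%g -> K = L.
Proof.
move=> EK EL Ww defL; have sKS := reps_sub EK.
have [M /setP eqM] := reps_class sKS.
have /set1P-> : K \in [set M].
  rewrite -eqM !inE EK sKS; apply/exists_inP; exists 1%g => //.
  by rewrite conjsg1.
apply/esym/set1P; rewrite -eqM !inE EL reps_sub //.
by apply/exists_inP; exists w; rewrite // defL.
Qed.

(** Nonzero marks in both directions put each parabolic subgroup inside a conjugate of the other, so
    K and L are conjugate. *)
Lemma mark_sep K L : K \in E -> L \in E ->
  (0 < mark W K L)%N -> (0 < mark W L K)%N -> K = L.
Proof.
move=> EK EL; have [sKS sLS] := (reps_sub EK, reps_sub EL).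
case/(mark_pos _ sKS)=> g Wg sLK /(mark_pos _ sLS)[h Wh sKL].
have [d Wd defL] := gen_conj_conj sKS sLS Wg Wh sLK sKL.
exact: reps_inj defL.
Qed.

Lemma x_char_conj K w (b : 'M[rat]_#|W|) :
  K \subset S -> (K :^ w)%g \subset S ->
  w \in W -> b \in descent_space W S -> x_char (K :^ w) b = x_char K b.
Proof.
move=> sKS sKwS Ww /descent_spanP[c ->].
rewrite [LHS]linear_sum [RHS]linear_sum; apply: eq_bigr => L sLS.
by rewrite [LHS]linearZ [RHS]linearZ !x_charE // mark_conjr.
Qed.

(** The family f is arbitrary so that the same expansion serves for the basis over Q and for its
    image modulo p. *)
Lemma x_mul_triangular (F : fieldType) (V : lmodType F)
    (f : {set gT} -> V) J K :
  J \subset S -> K \subset S -> exists c : {set gT} -> F,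
  \sum_(L : {set gT} | L \subset K) f L *+ solomon_coef J K L =
    (mark W J K)%:R *: f K +
    \sum_(L in powerset S | (#|L| < #|K|)%N) c L *: f L.
Proof.
move=> sJS sKS.
exists (fun L => if L \proper K then (solomon_coef J K L)%:R else 0).
rewrite (bigD1 K) //= scaler_nat mark_Solomon //; congr (_ + _).
rewrite [RHS](bigID (fun L => L \proper K)) /= [X in _ = _ + X]big1 ?addr0.
  apply: eq_big => [L|L /andP[sLK neqLK]].
    apply/andP/andP => [[sLK neqLK]|[_ ltLK]]; last first.
      by rewrite proper_sub // proper_neq.
    have ltLK : L \proper K by rewrite properEneq neqLK.
    by rewrite inE (subset_trans sLK) // proper_card.
  by rewrite properEneq neqLK sLK scaler_nat.
by move=> L /andP[_ /negPf->]; rewrite scale0r.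
Qed.

Lemma descent_irreps :
  exists lam : {set gT} -> {linear descent_algebra W S -> rat^o},
     [/\ forall (K J : {set gT}) (y : descent_algebra W S),
           K \in E -> J \subset S -> vsval y = x J ->
           lam K y = (mark W J K)%:R,
         irreps_are (descent_mul W S) (descent_one W S) E lam &
         {in E &, forall K K',
            isomorphic_repr (repr1 (lam K)) (repr1 (lam K')) -> K = K'}].
Proof.
pose lam K : {linear descent_algebra W S -> rat^o} := x_char K \o vsval.
have xD L : L \subset S -> x L \in descent_space W S.
  by move=> sLS; apply/memv_span/imageP; exists L; rewrite ?inE.
pose e L : descent_algebra W S := vsproj (descent_space W S) (x L).
have eK L : L \subset S -> vsval (e L) = x L by move/xD/vsprojK.
have lamE K J (y : descent_algebra W S) : K \subset S -> J \subset S ->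
    vsval y = x J -> lam K y = (mark W J K)%:R.
  by move=> sKS sJS /= ->; apply: x_charE.
exists lam; split=> [K J y /reps_sub sKS||]; [exact: lamE| |].
  split=> [K /reps_sub sKS|n rho irr].
    apply: repr1_irrep => [a b c|a] /= ->; last exact: x_char1.
    by apply: x_charM => //; apply: subvsP.
  have inS L : (L \in powerset S) = (L \subset S) by rewrite inE.
  have [||a|J K|K] := triangular_irrep (D := powerset S) (e := e)
      (rk := fun L => #|L|) (lam := lam) (top := S) _ _ _ _ irr.
  - by rewrite inS.
  - by rewrite /descent_one eK // x_S.
  - have [c defa] := descent_spanP (subvsP a); exists c; apply: val_inj => /=.
    rewrite linear_sum defa; apply: eq_big => [L|L sLS]; first by rewrite inS.
    by rewrite linearZ /= eK.
  - rewrite !inS => sJS sKS; have [c mulJK] := x_mul_triangular e sJS sKS.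
    exists c; rewrite (lamE K J) ?eK //.
    rewrite -mulJK /descent_mul linear_sum !eK // x_mul //.
    apply: eq_bigr => L sLK; rewrite linearMn /= eK //.
    exact: subset_trans sKS.
  (* The criterion yields some subset K of S; its representative in E has the same character. *)
  rewrite inS => sKS isoK; have [L EL [w Ww defL]] := reps_exists sKS.
  exists L => //; case: isoK => P freeP eqP; exists P => // a; rewrite eqP.
  rewrite /repr1; congr (_%:M *m _); rewrite defL; apply/esym/x_char_conj => //.
    by rewrite -defL reps_sub.
  exact: subvsP.
move=> K L EK EL /isomorphic_repr1 eq_lam.
have [sKS sLS] := (reps_sub EK, reps_sub EL).
have eq_mark J : J \subset S -> mark W J K = mark W J L.
  move=> sJS; have := eq_lam (e J).
  by rewrite !(lamE _ J) ?eK // => /eqP; rewrite Num.Theory.eqr_nat => /eqP.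
apply: mark_sep => //; first by rewrite -eq_mark // mark_diag_gt0.
by rewrite eq_mark // mark_diag_gt0.
Qed.

(** * Irreducible representations modulo p *)

Lemma lattice_span (b : 'M[rat]_#|W|) :
  b \in @descent_lattice gT W S -> b \in descent_space W S.
Proof.
case/asboolP=> a ->; apply: memv_suml => L sLS; rewrite -scaler_int memvZ //.
by apply/memv_span/imageP; exists L; rewrite ?inE.
Qed.

Lemma int_x_char K (z : int_descent W S) : K \subset S ->
  exists m : int, x_char K (val z) = m%:~R.
Proof.
move=> sKS; case/asboolP: (valP z) => a ->.
exists (\sum_(L : {set gT} | L \subset S) (mark W L K)%:Z *~ a L).
rewrite [LHS]linear_sum [RHS]rmorph_sum; apply: eq_bigr => L sLS.
transitivity ((mark W L K)%:R *~ a L : rat).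
  by rewrite [LHS]raddfMz; congr (_ *~ _); apply: x_charE.
by rewrite [RHS]raddfMz.
Qed.

Lemma mod_char_exists K : K \subset S ->
  exists l : {linear mod_descent W S p_pr -> ('F_p)^o},
    forall (z : int_descent W S) (m : int),
      x_char K (val z) = m%:~R -> l (mod_pi p_pr z) = m%:~R.
Proof.
move=> sKS; pose mu z := sval (cid (int_x_char z sKS)).
have muE z : x_char K (val z) = (mu z)%:~R by rewrite /mu; case: cid.
pose l0 (c : mod_descent W S p_pr) : ('F_p)^o :=
  (mu (generic_quotient.repr c))%:~R.
(* The value does not depend on the representative: a change by p times a lattice element changes
   the integral character by a multiple of p. *)
have l0E z (m : int) : x_char K (val z) = m%:~R -> l0 (mod_pi p_pr z) = m%:~R.
  move=> zm; rewrite /l0; set y := generic_quotient.repr _.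
  have : y - z \in int_descent_mulp (W := W) (S := S) p.
    rewrite (Quotient.idealrBE (int_descent_mulp (W := W) (S := S) p)).
    by apply/eqP; rewrite reprK.
  case/asboolP=> t yz.
  have muy : mu y = m + mu t *+ p.
    have yE : val y = val z + val t *+ p.
      by rewrite -[y](subrK z) yz addrC raddfD raddfMn.
    have xE : x_char K (val y) = x_char K (val z) + x_char K (val t) *+ p.
      by rewrite yE [LHS]linearD; congr (_ + _); apply: linearMn.
    by apply/eqP; rewrite -(eqr_int rat) -muE xE zm muE raddfD raddfMn.
  by rewrite muy raddfD raddfMn /= -mulr_natr pchar_Fp_0 // mulr0 addr0.
have l0_lin : linear (l0 : _ -> ('F_p)^o).
  move=> k u v; pose rep (c : mod_descent W S p_pr) : int_descent W S :=
    generic_quotient.repr c.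
  have repK c : mod_pi p_pr (rep c) = c by apply: reprK.
  have -> : k *: u + v = mod_pi p_pr (rep u *+ k + rep v).
    by rewrite -{1}[u]repK -{1}[v]repK /mod_pi raddfD raddfMn.
  rewrite (l0E _ (mu (rep u) *+ k + mu (rep v))).
    rewrite raddfD raddfMn /=; congr (_ + _); rewrite -mulr_natl.
    by congr (_ * _); apply: natr_Zp.
  have valE : val (rep u *+ k + rep v) = val (rep u) *+ k + val (rep v).
    by rewrite raddfD raddfMn.
  have xE : x_char K (val (rep u *+ k + rep v)) =
      x_char K (val (rep u)) *+ k + x_char K (val (rep v)).
    by rewrite valE [LHS]linearD; congr (_ + _); apply: linearMn.
  by rewrite xE !muE raddfD raddfMn.
pose l : {linear mod_descent W S p_pr -> ('F_p)^o} :=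
  HB.pack_for {linear mod_descent W S p_pr -> ('F_p)^o} l0
    (GRing.isLinear.Build 'F_p (mod_descent W S p_pr) ('F_p)^o _ l0 l0_lin).
by exists l.
Qed.

Lemma mod_descent_irreps :
  exists lam : {set gT} -> {linear mod_descent W S p_pr -> ('F_p)^o},
     (forall (K J : {set gT}) (y : int_descent W S),
        K \in E -> J \subset S -> val y = x J ->
        lam K (mod_pi p_pr y) = (mark W J K)%:R)
     /\ irreps_are (mod_mul W S p_pr) (mod_one W S p_pr) E lam.
Proof.
have ex_lam K : exists l : {linear mod_descent W S p_pr -> ('F_p)^o},
    K \subset S -> forall (z : int_descent W S) (m : int),
      x_char K (val z) = m%:~R -> l (mod_pi p_pr z) = m%:~R.
  have [/mod_char_exists[l lE]|] := boolP (K \subset S); first by exists l.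
  (* The zero map is a default for K outside the power set of S, needed to choose [lam] on all
     sets. *)
  by exists \0.
have [lam lamE] := choice ex_lam.
have lamM K (a b c : mod_descent W S p_pr) :
    K \subset S -> mod_mul W S p_pr a b c ->
    lam K c = lam K a * lam K b.
  move=> sKS [u [v [w [<- <- <- defw]]]].
  have [mu uE] := int_x_char u sKS; have [mv vE] := int_x_char v sKS.
  rewrite (lamE K sKS u mu) // (lamE K sKS v mv) // -rmorphM /=.
  apply: lamE => //; rewrite defw rmorphM /= -uE -vE.
  by apply: x_charM => //; apply: lattice_span; apply: valP.
have lam1 K (a : mod_descent W S p_pr) :
    K \subset S -> mod_one W S p_pr a -> lam K a = 1.
  move=> sKS [z <- z1]; rewrite (lamE K sKS z 1) //.
  by rewrite z1 x_char1.
have lam_mark K J (y : int_descent W S) : K \subset S -> J \subset S ->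
    val y = x J -> lam K (mod_pi p_pr y) = (mark W J K)%:R.
  move=> sKS sJS yJ; rewrite (lamE K sKS y (mark W J K)) ?pmulrn //.
  by rewrite yJ x_charE.
exists lam; split=> [K J y /reps_sub|]; first exact: lam_mark.
split=> [K /reps_sub sKS|n rho irr].
  by apply: repr1_irrep => [a b c|a]; [apply: lamM | apply: lam1].
pose xz L : int_descent W S := insubd 0 (x L).
have xzK L : L \subset S -> val (xz L) = x L.
  move=> sLS; rewrite insubdK //; apply/asboolP.
  exists (fun M => (M == L)%:Z); rewrite (bigD1 L) //= eqxx big1 ?addr0 //.
  by move=> M /andP[_ /negPf->]; rewrite mulr0z.
pose e L := mod_pi p_pr (xz L).
have inS L : (L \in powerset S) = (L \subset S) by rewrite inE.
have [||a|J K|K] := triangular_irrep (D := powerset S) (e := e)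
    (rk := fun L => #|L|) (lam := lam) (top := S) _ _ _ _ irr.
- by rewrite inS.
- by exists (xz S); rewrite // xzK // x_S.
- pose z : int_descent W S := generic_quotient.repr a.
  have <- : mod_pi p_pr z = a by apply: reprK.
  have /asboolP[k zE] := valP z; exists (fun L => (k L)%:~R).
  have -> : z = \sum_(L in powerset S) xz L *~ k L.
    apply: val_inj; rewrite [RHS]raddf_sum [LHS]zE.
    apply: eq_big => [L|L sLS]; first by rewrite inS.
    by rewrite [RHS]raddfMz; congr (_ *~ _); apply/esym/xzK.
  rewrite /mod_pi raddf_sum; apply: eq_bigr => L _.
  by rewrite raddfMz scaler_int.
- rewrite !inS => sJS sKS; have [c mulJK] := x_mul_triangular e sJS sKS.
  exists c; rewrite (lam_mark K J) ?xzK // -mulJK.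
  exists (xz J); exists (xz K).
  exists (\sum_(L : {set gT} | L \subset K) xz L *+ solomon_coef J K L).
  split=> //.
    rewrite /mod_pi raddf_sum; apply: eq_bigr => L _.
    by rewrite raddfMn.
  rewrite !xzK // x_mul // raddf_sum; apply: eq_bigr => L sLK.
  by rewrite raddfMn /= xzK // (subset_trans sLK).
rewrite inS => sKS isoK; have [L EL [w Ww defL]] := reps_exists sKS.
exists L => //; case: isoK => P freeP eqP; exists P => // a; rewrite eqP.
rewrite /repr1; congr (_%:M *m _).
have sLS := reps_sub EL.
pose z : int_descent W S := generic_quotient.repr a.
have <- : mod_pi p_pr z = a by apply: reprK.
have [m zm] := int_x_char z sKS.
rewrite (lamE K sKS z m) // (lamE L sLS z m) // -zm defL.
apply: x_char_conj; rewrite -?defL //.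
by apply: lattice_span; apply: valP.
Qed.

(** * Counting the distinct columns modulo p *)

Lemma index_normalizer_conj K w : w \in W ->
  #|'N_W(<<(K :^ w)%g>>) : <<(K :^ w)%g>>|%g = #|'N_W(<<K>>) : <<K>>|%g.
Proof.
move=> Ww; rewrite genJ normJ -{1}(conjGid Ww) -conjIg.
exact: indexJg.
Qed.

Lemma col_marksP (i j : 'I_#|E|) :
  reflect
    (forall J, J \in E ->
       mark W J (enum_val i) = mark W J (enum_val j) %[mod p])
    (col i (map_mx (fun b : nat => b%:R : 'F_p) (parabolic_table_of_marks W E))
     == col j (map_mx (fun b : nat => b%:R : 'F_p)
                      (parabolic_table_of_marks W E))).
Proof.
apply: (iffP eqP) => [/matrixP eq_ij J EJ|eq_ij].
  have := eq_ij (enum_rank_in EJ J) 0; rewrite !mxE enum_rankK_in //.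
  by move/(congr1 (fun a : 'F_p => a : nat)); rewrite /= !val_Fp_nat.
apply/matrixP=> k l; rewrite !mxE; apply: val_inj.
by rewrite /= !val_Fp_nat // eq_ij // enum_valP.
Qed.

(** The representatives with index prime to p biject with the columns: [mark_sep] gives injectivity
    and [mark_mod_rep] surjectivity. *)
Lemma card_mod_columns :
  #|[set col j (map_mx (fun b : nat => b%:R : 'F_p)
                       (parabolic_table_of_marks W E)) | j : 'I_#|E|]|
  = #|[set J in E | ~~ (p %| #|'N_W(<<J>>) : <<J>>|%g)%N]|.
Proof.
set M := map_mx _ _; set G := [set J in E | _].
have [K0 E_K0 _] := reps_exists (subxx S).
pose f K := col (enum_rank_in E_K0 K) M.
have f_inj : {in G &, injective f}.
  move=> K L /setIdP[EK nK] /setIdP[EL nL] /eqP/col_marksP eqKL.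
  rewrite !enum_rankK_in // in eqKL.
  (* The diagonal mark of J is nonzero modulo p, so any mark congruent to it is positive. *)
  have pos J n : J \in E -> ~~ (p %| #|'N_W(<<J>>) : <<J>>|%g)%N ->
      mark W J J = n %[mod p] -> (0 < n)%N.
    move=> EJ nJ eq_n; rewrite lt0n; apply: contraNneq nJ => n0.
    by rewrite -mark_diag ?reps_sub // /dvdn eq_n n0 mod0n.
  apply: mark_sep => //.
    exact: pos EK nK (eqKL K EK).
  exact: pos EL nL (esym (eqKL L EL)).
rewrite -(card_in_imset f_inj); apply: eq_card => c.
apply/imsetP/imsetP => [[j _ ->]|[K /setIdP[EK _] ->]]; last first.
  by exists (enum_rank_in E_K0 K).
have Ej := enum_valP j.
have [L [sLS nL] eqL] := mark_mod_rep (reps_sub Ej).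
have [L' EL' [w Ww defL']] := reps_exists sLS.
exists L'.
  by rewrite inE EL' defL' index_normalizer_conj.
apply/eqP/col_marksP => J EJ; rewrite enum_rankK_in // eqL ?reps_sub //.
by rewrite defL' mark_conjr.
Qed.

End Representatives.

End Inversions.

Local Open Scope ring_scope.

Theorem lemma4 (gT : finGroupType) (W : {group gT}) (S : {set gT})
    (E : {set {set gT}}) (p : nat) (p_pr : prime p) :
  coxeter_system W S ->
  subset_class_reps W S E ->
  (exists lam : {set gT} -> {linear descent_algebra W S -> rat^o},
     [/\ forall (K J : {set gT}) (x : descent_algebra W S),
           K \in E -> J \subset S -> vsval x = x_elt W S J ->
           lam K x = (mark W J K)%:R,
         irreps_are (descent_mul W S) (descent_one W S) E lam &
         {in E &, forall K K',
            isomorphic_repr (repr1 (lam K)) (repr1 (lam K')) -> K = K'}])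
  /\
  (exists lam : {set gT} -> {linear mod_descent W S p_pr -> ('F_p)^o},
     (forall (K J : {set gT}) (x : int_descent W S),
        K \in E -> J \subset S -> val x = x_elt W S J ->
        lam K (mod_pi p_pr x) = (mark W J K)%:R)
     /\ irreps_are (mod_mul W S p_pr) (mod_one W S p_pr) E lam)
  /\
  #|[set col j (map_mx (fun b : nat => b%:R : 'F_p)
                       (parabolic_table_of_marks W E)) | j : 'I_#|E|]|
  = #|[set J in E | ~~ (p %| #|'N_W(<<J>>) : <<J>>|%g)%N]|.
Proof.
move=> coxWS repsE; have [inv invP] := inversion_cocycle_exists coxWS.
split; first exact: (descent_irreps coxWS invP repsE).
split; first exact: (mod_descent_irreps coxWS invP p_pr repsE).
exact: (card_mod_columns coxWS invP p_pr repsE).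
Qed.
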